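(* Let $\mathcal H_1,\mathcal H_2$ be finite-dimensional complex Hilbert spaces, let $d=\dim(\mathcal H_1\otimes\mathcal H_2)$, and let $\eta_2=\{p_b,\rho_b\}_b$ be any finite ensemble of density operators $\rho_b$ on $\mathcal H_1\otimes\mathcal H_2$ with probabilities $p_b$. Let $\epsilon_{\eta_2}=\{p_b,\sigma_b\}_b$ be the closest ensemble of (fully) separable states to $\eta_2$, and let $\mathbb R_1^M(\eta_2)=\max_b R_1(\rho_b\|\tfrac{I_d}{d})$ be the maximum random robustness of entanglement of $\eta_2$. Then for every discrimination scheme $X$, the optimal success probability of discriminating the states of the ensemble satisfies $$P_X(\eta_2)\le P_X(\epsilon_{\eta_2})\left[1+\mathbb R_1^M(\eta_2)\right].$$
   Context: Ensembles: an ensemble $\{p_b,\rho_b\}_b$ consists of finitely many density operators $\rho_b$ on a common Hilbert space with $p_b\ge 0$, $\sum_b p_b=1$. Separability: a density operator on $\mathcal H_1\otimes\mathcal H_2$ is separable if it is a convex mixture of pure product states. Random robustness of entanglement: for a density operator $\rho$ on $\mathcal H_1\otimes\mathcal H_2$, $R_1(\rho\|\tfrac{I_d}{d})$ is the minimum $r\ge 0$ such that $\frac{\rho+r I_d/d}{1+r}$ is separable, where $I_d$ is the identity operator. This minimum is finite. Closest separable ensemble: for $\eta_2=\{p_b,\rho_b\}_b$, write $\boldsymbol R_b=R_1(\rho_b\|\tfrac{I_d}{d})$ and $\sigma_b=\frac{\rho_b+\boldsymbol R_b I_d/d}{1+\boldsymbol R_b}$; then $\epsilon_{\eta_2}=\{p_b,\sigma_b\}_b$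 (same probabilities). Discrimination schemes: a discrimination scheme $X$ is specified by a nonempty set $\boldsymbol X$ of allowed POVMs $\{M_b\}_b$ on $\mathcal H_1\otimes\mathcal H_2$ (so $M_b\ge 0$, $\sum_b M_b=I_d$), with outcomes indexed by the same index set as the ensemble (outcome $b$ means guessing the state with index $b$); examples are all POVMs (global), local operations, or LOCC. The optimal success probability for an ensemble $\{p_b,\tau_b\}_b$ is $P_X(\{p_b,\tau_b\}_b)=\max_{\{M_b\}\in\boldsymbol X}\sum_b p_b\operatorname{Tr}[M_b\tau_b]$ (read as a supremum if the maximum is not attained). *)

(* Defs.v *)
From HB Require Import structures.
From mathcomp Require Import all_boot all_order all_algebra.
From mathcomp Require Import all_classical all_reals.
From mathcomp Require Export complex mxtens.

Set Implicit Arguments.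
Unset Strict Implicit.
Unset Printing Implicit Defensive.

Import Order.TTheory GRing.Theory Num.Theory.
Local Open Scope classical_set_scope.
Local Open Scope complex_scope.
Local Open Scope sesquilinear_scope.
Local Open Scope ring_scope.

(* The complex numbers are R[i] for an arbitrary
   R : realType; H_1 and H_2 are C^m and C^n, their tensor product is C^(m * n)
   with the Kronecker product *t, and operators are matrices. *)

(* In R[i], 0 <= z says that z is real and nonnegative, so positivity of all
   the quadratic values also forces A to be Hermitian. *)
Definition positive_op (R : realType) (k : nat) (A : 'M[R[i]]_k) : Prop :=
  forall v : 'cV[R[i]]_k, 0 <= (v ^t* *m A *m v) 0 0.

Definition density_op (R : realType) (k : nat) (A : 'M[R[i]]_k) : Prop :=
  positive_op A /\ \tr A = 1.

Definition unit_vector (R : realType) (k : nat) (v : 'cV[R[i]]_k) : Prop :=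
  v ^t* *m v = 1%:M.

(* |v><v| *)
Definition pure_state (R : realType) (k : nat) (v : 'cV[R[i]]_k) :
  'M[R[i]]_k := v *m v ^t*.

Definition separable (R : realType) (m n : nat) (A : 'M[R[i]]_(m * n)) : Prop :=
  exists (N : nat) (q : 'I_N -> R)
         (u : 'I_N -> 'cV[R[i]]_m) (v : 'I_N -> 'cV[R[i]]_n),
    [/\ forall k, 0 <= q k,
        \sum_k q k = 1,
        forall k, unit_vector (u k),
        forall k, unit_vector (v k)
      & A = \sum_k (q k)%:C *: (pure_state (u k) *t pure_state (v k))].

(* (A + r I_d / d) / (1 + r), where d = m * n *)
Definition mix_identity (R : realType) (m n : nat) (A : 'M[R[i]]_(m * n))
    (r : R) : 'M[R[i]]_(m * n) :=
  ((1 + r)^-1)%:C *: (A + (r / (m * n)%:R)%:C *: 1%:M).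

(* The minimum of the set below, expressed as its infimum: for a density
   operator the set is nonempty and closed. *)
Definition random_robustness (R : realType) (m n : nat)
    (A : 'M[R[i]]_(m * n)) : R :=
  inf [set r : R | 0 <= r /\ separable (mix_identity A r)].

Definition ensemble (R : realType) (k : nat) (B : finType) (p : B -> R)
    (rho : B -> 'M[R[i]]_k) : Prop :=
  [/\ forall b, 0 <= p b, \sum_b p b = 1 & forall b, density_op (rho b)].

Definition closest_separable (R : realType) (m n : nat) (B : finType)
    (rho : B -> 'M[R[i]]_(m * n)) (b : B) : 'M[R[i]]_(m * n) :=
  mix_identity (rho b) (random_robustness (rho b)).

(* Robustness being nonnegative, the default value 0 of the iterated maximum
   is harmless: B is nonempty for an ensemble. *)
Definition max_random_robustness (R : realType) (m n : nat) (B : finType)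
    (rho : B -> 'M[R[i]]_(m * n)) : R :=
  \big[Num.max/0]_b random_robustness (rho b).

Definition povm (R : realType) (k : nat) (B : finType)
    (M : B -> 'M[R[i]]_k) : Prop :=
  (forall b, positive_op (M b)) /\ \sum_b M b = 1%:M.

Definition discrimination_scheme (R : realType) (k : nat) (B : finType)
    (X : set (B -> 'M[R[i]]_k)) : Prop :=
  X !=set0 /\ (forall M, X M -> povm M).

(* The traces are real for a POVM and density operators; Re only changes
   their type from R[i] to R. *)
Definition success_probability (R : realType) (k : nat) (B : finType)
    (p : B -> R) (tau M : B -> 'M[R[i]]_k) : R :=
  \sum_b p b * complex.Re (\tr (M b *m tau b)).

Definition optimal_success (R : realType) (k : nat) (B : finType)
    (X : set (B -> 'M[R[i]]_k)) (p : B -> R) (tau : B -> 'M[R[i]]_k) : R :=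
  sup [set success_probability p tau M | M in X].

(* Main.v *)
(** The states satisfy rho_b = (1 + R_b) sigma_b - (R_b / d) I, so
    Tr (M_b rho_b) <= (1 + R_b) Tr (M_b sigma_b) for each positive M_b, and
    R_b is at most the maximal robustness. Averaging over b bounds the success
    probability of every POVM; boundedness of the success probabilities of
    the sigma_b then lets the inequality pass to the suprema. *)

Require Import Defs.
From mathcomp Require Import all_boot all_order all_algebra.
From mathcomp Require Import all_classical all_reals.
Local Open Scope classical_set_scope.
Local Open Scope complex_scope.
Local Open Scope ring_scope.
Import Order.TTheory GRing.Theory Num.Theory.
Local Open Scope sesquilinear_scope.
Set Implicit Arguments.
Unset Strict Implicit.
Unset Printing Implicit Defensive.

(** Polarization: the form [f u v] is conjugate-linear in [u] and linear in [v], so its vanishing on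
    the diagonal makes it antisymmetric, while the substitution of ['i *: u] for [u] makes it
    symmetric. *)
Lemma quadratic_form_eq0 (C : numClosedFieldType) (k : nat) (A : 'M[C]_k) :
  (forall v : 'cV[C]_k, (v ^t* *m A *m v) 0 0 = 0) -> A = 0.
Proof.
move=> A0.
pose f (u v : 'cV[C]_k) := (u ^t* *m A *m v) 0 0.
have fDl u v w : f (u + v) w = f u w + f v w.
  by rewrite /f raddfD /= map_mxD !mulmxDl [LHS]mxE.
have fDr u v w : f u (v + w) = f u v + f u w.
  by rewrite /f mulmxDr [LHS]mxE.
have fZl c u v : f (c *: u) v = c^* * f u v.
  by rewrite /f linearZ /= map_mxZ -!scalemxAl [LHS]mxE.
have fZr c u v : f u (c *: v) = c * f u v.
  by rewrite /f -scalemxAr [LHS]mxE.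
have fDC u v : f u v + f v u = 0.
  have := A0 (u + v); rewrite -/(f _ _) fDl !fDr [f u u]A0 [f v v]A0.
  by rewrite addr0 add0r.
have f0 u v : f u v = 0.
  have fE : f v u = f u v.
    have := fDC ('i *: u) v; rewrite fZl fZr conjCi mulNr addrC => /eqP.
    by rewrite subr_eq0 => /eqP /(mulfI (neq0Ci C)).
  by have := fDC u v; rewrite fE => /eqP; rewrite -mulr2n mulrn_eq0 /= => /eqP.
(* On basis vectors [f] reads off the entries of [A]. *)
apply/matrixP => i j; have := f0 (delta_mx i 0) (delta_mx j 0).
by rewrite /f trmx_delta map_delta_mx -rowE -colE !mxE.
Qed.

(** The quadratic form of the adjoint is the conjugate of that of [A]. Nonnegative values are real,
    so the two forms agree and the difference of the operators has zero form. *)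
Lemma positive_op_hermitian (R : realType) (k : nat) (A : 'M[R[i]]_k) :
  positive_op A -> A \is hermsymmx.
Proof.
move=> A_ge0; apply/is_hermitianmxP; rewrite expr0 scale1r.
apply/eqP; rewrite -subr_eq0; apply/eqP/quadratic_form_eq0 => v.
rewrite mulmxBr mulmxBl.
have -> : v ^t* *m A ^t* *m v = (v ^t* *m A *m v) ^t*.
  by rewrite !trmx_mul !map_mxM /= trmxCK mulmxA.
rewrite !mxE; apply/eqP; rewrite subr_eq0; apply/eqP/esym/geC0_conj.
by have := A_ge0 v; rewrite mxE.
Qed.

(** Diagonalize [B] by a unitary [P]. By cyclicity the trace is the sum of the diagonal entries of
    [P *m A *m P ^t*] weighted by the eigenvalues of [B], all of them nonnegative. *)
Lemma mxtrace_mul_positive_ge0 (R : realType) (k : nat) (A B : 'M[R[i]]_k) :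
  positive_op A -> positive_op B -> 0 <= \tr (A *m B).
Proof.
move=> A_ge0 B_ge0.
have /hermitian_normalmx/orthomx_spectralP := positive_op_hermitian B_ge0.
set P := spectralmx B; set D := spectral_diag B.
have Pu : P \is unitarymx by exact: spectral_unitarymx.
rewrite invmx_unitary // => BE.
have PP : P *m P ^t* = 1%:M by exact/unitarymxP.
(* This entry is the quadratic form of [C] at the adjoint of row [i] of [P]. *)
have entry_ge0 (C : 'M[R[i]]_k) i : positive_op C ->
    0 <= (P *m C *m P ^t*) i i.
  move=> /(_ ((row i P) ^t*)); rewrite trmxCK -row_mul.
  by congr (0 <= _); rewrite !mxE; apply: eq_bigr => j _; rewrite !mxE.
have DE : diag_mx D = P *m B *m P ^t*.
  by rewrite BE !mulmxA PP mul1mx -mulmxA PP mulmx1.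
rewrite BE !mulmxA mxtrace_mulC !mulmxA.
rewrite /mxtrace; apply: sumr_ge0 => i _.
rewrite mul_mx_diag mxE mulr_ge0 ?entry_ge0 //.
by have := entry_ge0 B i B_ge0; rewrite -DE mxE eqxx.
Qed.

Lemma random_robustness_ge0 (R : realType) (m n : nat) (A : 'M[R[i]]_(m * n)) :
  0 <= random_robustness A.
Proof.
rewrite /random_robustness; set E := [set r | _].
(* The infimum of the empty set is 0 by convention. *)
have [->|/set0P E0] := eqVneq E set0; first by rewrite inf0.
by apply: lb_le_inf => // r [].
Qed.

Lemma positive_op1 (R : realType) (k : nat) :
  positive_op (1%:M : 'M[R[i]]_k).
Proof.
move=> v; rewrite mulmx1 mxE; apply: sumr_ge0 => i _.
by rewrite !mxE mulrC mul_conjC_ge0.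
Qed.

Lemma mix_identity_positive (R : realType) (m n : nat) (A : 'M[R[i]]_(m * n))
    (r : R) :
  0 <= r -> positive_op A -> positive_op (mix_identity A r).
Proof.
move=> r0 A0 v; rewrite /mix_identity -scalemxAr -scalemxAl mxE.
rewrite mulr_ge0 ?ler0c ?invr_ge0 ?addr_ge0 //.
rewrite mulmxDr mulmxDl mxE addr_ge0 ?A0 //.
rewrite -scalemxAr -scalemxAl mxE mulr_ge0 ?ler0c ?divr_ge0 //.
exact: positive_op1.
Qed.

Lemma Re_ge0 (R : realType) (z : R[i]) : 0 <= z -> 0 <= complex.Re z.
Proof. by rewrite lecE => /andP[]. Qed.

Lemma Re_scale (R : realType) (c : R) (z : R[i]) :
  complex.Re (c%:C * z) = c * complex.Re z.
Proof. by case: z => x y /=; rewrite mul0r subr0. Qed.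

Lemma mxtrace_mul_le_mix_identity (R : realType) (m n : nat)
    (M A : 'M[R[i]]_(m * n)) (r : R) :
  0 <= r -> positive_op M ->
  complex.Re (\tr (M *m A)) <=
  (1 + r) * complex.Re (\tr (M *m mix_identity A r)).
Proof.
move=> r0 M0; rewrite /mix_identity -scalemxAr mxtraceZ Re_scale mulrA.
rewrite mulfV ?mul1r; last by rewrite gt_eqF // ltr_pwDl.
(* With [1 + r] cancelled, the two sides differ by [r / d] times the trace of [M]. *)
rewrite mulmxDr mxtraceD raddfD /= lerDl -scalemxAr mxtraceZ Re_scale.
rewrite mulr_ge0 ?divr_ge0 // Re_ge0 //.
exact/mxtrace_mul_positive_ge0/positive_op1.
Qed.

(** The traces against all outcomes add up to that of [A], and none is negative. The bound is
    uniform in the POVM, which makes the success probabilities bounded. *)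
Lemma povm_trace_le (R : realType) (k : nat) (B : finType)
    (M : B -> 'M[R[i]]_k) (A : 'M[R[i]]_k) (b : B) :
  povm M -> positive_op A ->
  complex.Re (\tr (M b *m A)) <= complex.Re (\tr A).
Proof.
move=> [M0 M1] A0.
have -> : \tr A = \sum_c \tr (M c *m A).
  by rewrite -raddf_sum /= -mulmx_suml M1 mul1mx.
rewrite (bigD1 b) //= raddfD /= lerDl Re_ge0 // sumr_ge0 // => c _.
exact: mxtrace_mul_positive_ge0.
Qed.

Theorem theorem1 (R : realType) (m n : nat) (B : finType)
    (p : B -> R) (rho : B -> 'M[R[i]]_(m * n))
    (eta2 : ensemble p rho)
    (X : set (B -> 'M[R[i]]_(m * n))) (hX : discrimination_scheme X) :
  optimal_success X p rho
    <= optimal_success X p (closest_separable rho)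
       * (1 + max_random_robustness rho).
Proof.
case: eta2 hX => p0 _ rho0 [[M0 XM0] Xpovm].
have sigma0 b : positive_op (closest_separable rho b).
  exact/mix_identity_positive/(rho0 b).1/random_robustness_ge0.
have maxR b : random_robustness (rho b) <= max_random_robustness rho.
  exact: le_bigmax.
have maxR_ge0 : 0 <= max_random_robustness rho by exact: bigmax_ge_id.
apply: ge_sup; first by exists (success_probability p rho M0); exists M0.
move=> _ [M XM <-]; have [M_ge0 _] := Xpovm M XM.
(* The inequality is first proved for the fixed measurement [M], outcome by outcome. *)
apply: (@le_trans _ _ (success_probability p (closest_separable rho) M
    * (1 + max_random_robustness rho))).
  rewrite /success_probability mulr_suml; apply: ler_sum => b _.
  rewrite -mulrA ler_wpM2l //.
  have R0 := random_robustness_ge0 (rho b).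
  apply: le_trans (mxtrace_mul_le_mix_identity _ R0 _) _ => //.
  rewrite [leRHS]mulrC ler_wpM2r ?lerD2l ?maxR //.
  by rewrite Re_ge0 // mxtrace_mul_positive_ge0 //; exact: sigma0.
rewrite ler_wpM2r ?addr_ge0 //; apply: ub_le_sup; last by exists M.
(* [ub_le_sup] requires an upper bound over all of [X]; each outcome contributes at most the full
   trace of its state. *)
exists (\sum_b p b * complex.Re (\tr (closest_separable rho b))).
move=> _ [N XN <-]; apply: ler_sum => b _.
by rewrite ler_wpM2l // povm_trace_le //; exact: Xpovm.
Qed.
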